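(* Let $b,r\ge 1$ and let $S$ be a standard skew tableau with $b$ rows, each of size $r$. Then $S$ stabilizes at $b$; consequently $\operatorname{stab}(S)\le b$.
   Context: Tableaux use English notation; rows are indexed from top to bottom. A standard skew tableau with $m$ cells is a filling of a skew shape by $1,\dots,m$, each used once, increasing along rows and down columns. The row vector of a skew tableau is the sequence of its row lengths from top to bottom; it is ''decreasing'' if these lengths weakly decrease from top to bottom. $\operatorname{Rect}(S)$ denotes the jeu de taquin rectification of $S$. The reading word of a skew tableau reads each row left to right, from the bottom row to the top row. For a word $u$ and an integer $m$, $u+m$ adds $m$ to every letter, and $u^{(k)}=u\,(u+m)\,(u+2m)\cdots(u+(k-1)m)$ (with $m$ understood from context). For a standard skew tableau $S$ with $m$ cells and decreasing row vector and $k\ge 1$, $S^{(k)}$ is the standard skew tableau obtained by attaching $k-1$ shifted copies of $S$ to the right of $S$: row $i$ of $S^{(k)}$ begins in the same column as row $i$ of $S$ and consists of the entries of row $i$ of $S$, followed by these entries plus $m$, followed by these entries plus $2m$, ..., followed by these entries plus $(k-1)m$. (Thus if $w_1,\dots,w_b$ are the rows of $S$ read left to right, starting from the bottom row, the reading word of $S^{(k)}$ is $w_1^{(k)}\cdots w_b^{(k)}$.) $S$ stabilizes at $k$ if every entry in $[(k-1)m+1,km]$ lies in the same row of $\operatorname{Rect}(S^{(k)})$ as in $S^{(k)}$; $\operatorname{stab}(S)$ is the least $k\ge1$ at which $S$ stabilizes. *)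

(* Defs.v *)
From mathcomp Require Import all_boot.
Set Implicit Arguments. Unset Strict Implicit. Unset Printing Implicit Defensive.

(* A grid is a list of rows (top to bottom, English notation).  In row i,
   position j < size row is a cell of the outer shape lambda; the value None
   marks a cell of the inner shape mu (or the moving hole), Some x a filled
   cell.  Positions j >= size row are outside lambda. *)
Definition grid := seq (seq (option nat)).

(* A skew tableau given by the starting column (offset) of each row, i.e. mu_i,
   and the entries of each row read left to right. *)
Record skew := Skew { offs : seq nat; rows : seq (seq nat) }.

Definition to_grid (S : skew) : grid :=
  [seq nseq o.1 None ++ map Some o.2 | o <- zip (offs S) (rows S)].

Definition ncells (S : skew) : nat := size (flatten (rows S)).

Definition cell (G : grid) (i j : nat) : option nat := nth None (nth [::] G i) j.

Definition is_standard_skew (S : skew) : Prop :=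
  [/\ size (offs S) = size (rows S) /\ sorted geq (offs S),
      sorted geq [seq o.1 + size o.2 | o <- zip (offs S) (rows S)],
      all (sorted ltn) (rows S),
      (forall i j x y, cell (to_grid S) i j = Some x ->
                       cell (to_grid S) i.+1 j = Some y -> x < y)
    & perm_eq (flatten (rows S)) (iota 1 (ncells S))].

Definition decreasing_rows (S : skew) : bool := sorted geq (map size (rows S)).

Definition skew_pow (S : skew) (k : nat) : skew :=
  Skew (offs S)
       [seq flatten [seq [seq x + t * ncells S | x <- w] | t <- iota 0 k] | w <- rows S].

Definition set_cell (G : grid) (i j : nat) (v : option nat) : grid :=
  set_nth [::] G i (set_nth None (nth [::] G i) j v).

(* One jeu de taquin slide: the hole (an empty cell) is at (i,j); the smaller
   of its right and lower neighbours moves into it; when the hole has no such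
   neighbour it is an outer corner and is removed from the shape.
   fuel is an upper bound on the number of moves (always large enough below). *)
Fixpoint slide_from (fuel : nat) (G : grid) (i j : nat) : grid :=
  match fuel with
  | 0 => G
  | fuel'.+1 =>
    let mv_right x := slide_from fuel' (set_cell (set_cell G i j (Some x)) i j.+1 None) i j.+1 in
    let mv_down y := slide_from fuel' (set_cell (set_cell G i j (Some y)) i.+1 j None) i.+1 j in
    match cell G i j.+1, cell G i.+1 j with
    | None, None => set_nth [::] G i (take j (nth [::] G i))
    | Some x, None => mv_right x
    | None, Some y => mv_down y
    | Some x, Some y => if x < y then mv_right x else mv_down y
    end
  end.

Definition gsize (G : grid) : nat := sumn (map size G).

Definition nlead (row : seq (option nat)) : nat := find isSome row.

(* Rectification: repeatedly slide into an inner corner (we always choose the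
   inner corner of the lowest row of mu, i.e. the cell (i, mu_i - 1) for the
   largest i with mu_i > 0) until mu is empty.  By the fundamental theorem of
   jeu de taquin the result does not depend on the choice of inner corners. *)
Fixpoint rect_fuel (fuel : nat) (G : grid) : grid :=
  match fuel with
  | 0 => G
  | fuel'.+1 =>
    let cs := [seq i <- iota 0 (size G) | 0 < nlead (nth [::] G i)] in
    if cs is [::] then G else
    let i := last 0 cs in
    rect_fuel fuel' (slide_from (gsize G + size G) G i (nlead (nth [::] G i)).-1)
  end.

Definition Rect (S : skew) : grid :=
  let G := to_grid S in rect_fuel (gsize G).+1 G.

Definition row_of (G : grid) (e : nat) : nat :=
  find (fun row : seq (option nat) => Some e \in row) G.

Definition stabilizes_at (S : skew) (k : nat) : Prop :=
  forall e, (k.-1 * ncells S < e <= k * ncells S) ->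
    row_of (Rect (skew_pow S k)) e = row_of (to_grid (skew_pow S k)) e.

(* stab(S) <= n, i.e. the least k >= 1 at which S stabilizes is at most n *)
Definition stab_le (S : skew) (n : nat) : Prop :=
  exists k, [/\ 1 <= k, k <= n & stabilizes_at S k].

(* Main.v *)
(* Think of the entries as times and let j particles sit on distinct rows,
   each particle being allowed to move only upwards as time passes.  A
   configuration scores the number of entries e <= n whose row is occupied at
   time e (the families of disjoint chains of Greene's theorem).  The maximal
   score is invariant under jeu de taquin: if the entry p moves up from row i+1
   to row i, exchange these two rows for the particles during the maximal run of
   times before (or after) p when exactly one of the rows i, i+1 is occupied;
   comparing columns, this loses nothing.  For a straight shape the maximal score
   is the number of entries <= n in the first j rows.

   In S^(b), a particle moving from row i+1 to row i gains at most
   M_i = max_l (#{x <= l in row i+1 of S} - #{x <= l in row i of S}), whatever the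
   number of blocks, and the particle c goes from a row <= b-j+c to a row >= c.  So
   n = bm scores at most jbr + sum_c sum_(c <= i < b-j+c) M_i.  Letting the particle
   c make its s-th step at the optimal moment of the block c+s, all these gains are
   already realised within b-1 blocks.  Hence the last block has at most jr entries in
   the first j rows of the rectification, as many as it has in S^(b); entries
   only move up, so none of them has moved. *)
Require Import Defs.
From mathcomp Require Import all_boot.
From mathcomp Require Import zify.
Set Implicit Arguments. Unset Strict Implicit. Unset Printing Implicit Defensive.

(** * Particle families *)

(** [pos c e] is the row of particle [c] at time [e]. Particles are numbered from the top and have a
    row at every time, so that a path can be altered on an interval of times. *)
Definition particles (b j : nat) (pos : nat -> nat -> nat) : Prop :=
  [/\ forall c c' e, c < c' -> c' < j -> pos c e < pos c' e,
      forall c e, c < j -> pos c e.+1 <= pos c e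
    & forall c e, c < j -> pos c e < b].

Definition occ (j : nat) (pos : nat -> nat -> nat) (e a : nat) : bool :=
  [exists c : 'I_j, pos c e == a].

Lemma occP j pos e a :
  reflect (exists2 c, c < j & pos c e = a) (occ j pos e a).
Proof.
apply: (iffP existsP) => [[c /eqP <-]|[c cj <-]]; first by exists c.
by exists (Ordinal cj).
Qed.

Lemma occE b j pos e a : particles b j pos ->
  occ j pos e a = \sum_(c < j) (pos c e == a) :> nat.
Proof.
case=> inc _ _; case: occP => [[c cj <-]|no].
  rewrite (bigD1 (Ordinal cj)) //= eqxx big1 // => c' nc.
  apply/eqP; rewrite eqb0; apply/eqP => E.
  have: nat_of_ord c' != c by [].
  by rewrite neq_ltn => /orP[] l; [have := inc _ _ e l cj|
    have := inc _ _ e l (ltn_ord c')]; rewrite E ltnn.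
by rewrite big1 // => c _; apply/eqP; rewrite eqb0; apply/eqP => E; case: no; exists c.
Qed.

(** The [c] particles above particle [c] and the [j - c - 1] below it all occupy distinct rows. *)
Lemma particles_bounds b j pos c e : particles b j pos -> c < j ->
  c <= pos c e /\ pos c e + (j - c) <= b.
Proof.
case=> inc _ bd; split.
  elim: c H => // c IH cj; apply: leq_ltn_trans (inc c c.+1 e _ cj) => //.
  by apply: IH; lia.
have [d] := ubnP (j - c); elim: d c H => // d IH c cj dj.
have [/eqP E|cj'] := boolP (c.+1 == j).
  by have := bd c e cj; lia.
have := inc c c.+1 e (ltnSn _) ltac:(lia); have := IH c.+1 ltac:(lia) ltac:(lia); lia.
Qed.

Definition swap (i a : nat) : nat :=
  if a == i then i.+1 else if a == i.+1 then i else a.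

Lemma swapK i : involutive (swap i).
Proof. by move=> a; rewrite /swap; do ?case: eqP; lia. Qed.

Definition flip (i : nat) (run : pred nat) (pos : nat -> nat -> nat) c e :=
  if run e then swap i (pos c e) else pos c e.

Lemma occ_flip i run j pos e a :
  occ j (flip i run pos) e a =
  if run e then occ j pos e (swap i a) else occ j pos e a.
Proof.
rewrite /flip; apply/occP/idP; case: (run e).
- by case=> c cj <-; apply/occP; exists c; rewrite ?swapK.
- by case=> c cj <-; apply/occP; exists c.
- by move=> /occP[c cj E]; exists c; rewrite // E swapK.
- by move=> /occP[c cj E]; exists c.
Qed.

Definition only j pos (i i' e : nat) := occ j pos e i && ~~ occ j pos e i'.

Lemma onlyP j pos i i' e : only j pos i i' e ->
  (exists2 c, c < j & pos c e = i) /\ forall c, c < j -> pos c e <> i'.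
Proof.
move=> /andP[/occP ex /occP no]; split=> // c cj E; by apply: no; exists c.
Qed.

(** The run may end at any time, since going from row [i.+1] to a row at most [i] is an upward step.
    Only its beginning is delicate: a particle already in row [i] just before would have to step
    down, and maximality of the run excludes this. *)
Lemma particles_flip_down b j pos i (run : pred nat) : particles b j pos -> i.+1 < b ->
  (forall e, run e -> only j pos i i.+1 e) ->
  (forall e, run e.+1 -> ~~ run e -> ~~ only j pos i i.+1 e) ->
  particles b j (flip i run pos).
Proof.
case=> inc dec bd ib high stop; split=> [c c' e cc cj|c e cj|c e cj]; rewrite /flip.
- case: ifP => [/high/onlyP[_ no]|_]; last exact: inc.
  have := inc c c' e cc cj; have := no c' cj.
  by rewrite /swap; do ?case: eqP; lia.
- have D := dec c e cj.
  case: (boolP (run e.+1)) => [re1|_]; case: (boolP (run e)) => [re|re] //.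
  + have [_ no] := onlyP (high _ re); have [_ no1] := onlyP (high _ re1).
    have := no c cj; have := no1 c cj.
    by rewrite /swap; do ?case: eqP; lia.
  + have [_ no1] := onlyP (high _ re1).
    have := no1 c cj => nc; rewrite /swap; case: eqP => [E|_]; last by case: eqP; lia.
    rewrite ltn_neqAle -{2}E D andbT; apply/negP => /eqP E'.
    (* If [c] were in row [i] at both times, row [i.+1] would be occupied at time [e] by some [c']
       below it. Row [i.+1] being empty at time [e.+1], [c'] would have caught up with [c]. *)
    have := stop _ re1 re; rewrite /only negb_and negbK => /orP[/occP[]|/occP[c' cj' E2]].
      by exists c.
    have D' := dec c' e cj'; have n1 := no1 c' cj'.
    have l : c < c'.
      rewrite ltnNge leq_eqVlt; apply/negP => /orP[/eqP X|X]; first by rewrite X in E2; lia.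
      by have := inc _ _ e X cj; lia.
    by have := inc _ _ e.+1 l cj'; lia.
  + have [_ no] := onlyP (high _ re); have := no c cj.
    by rewrite /swap; do ?case: eqP; lia.
- have := bd c e cj; rewrite /swap; case: ifP => // _; do ?case: eqP; lia.
Qed.

(** Mirror image in time: raising a particle early is harmless at the start of the run, and
    maximality is needed at its end. *)
Lemma particles_flip_up b j pos i (run : pred nat) : particles b j pos -> i.+1 < b ->
  (forall e, run e -> only j pos i.+1 i e) ->
  (forall e, run e -> ~~ run e.+1 -> ~~ only j pos i.+1 i e.+1) ->
  particles b j (flip i run pos).
Proof.
case=> inc dec bd ib low stop; split=> [c c' e cc cj|c e cj|c e cj]; rewrite /flip.
- case: ifP => [/low/onlyP[_ no]|_]; last exact: inc.
  have := inc c c' e cc cj; have := no c ltac:(lia).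
  by rewrite /swap; do ?case: eqP; lia.
- have D := dec c e cj.
  case: (boolP (run e.+1)) => [re1|re1]; case: (boolP (run e)) => [re|re] //.
  + have [_ no] := onlyP (low _ re); have [_ no1] := onlyP (low _ re1).
    have := no c cj; have := no1 c cj.
    by rewrite /swap; do ?case: eqP; lia.
  + have [_ no] := onlyP (low _ re1); have := no c cj.
    by rewrite /swap; do ?case: eqP; lia.
  + have [_ no] := onlyP (low _ re).
    have nc := no c cj; rewrite /swap; case: eqP => [//|_]; case: eqP => [E|_]; last by [].
    rewrite -ltnS ltn_neqAle -{2}E D andbT; apply/negP => /eqP E'.
    have := stop _ re re1; rewrite /only negb_and negbK => /orP[/occP[]|/occP[c' cj' E2]].
      by exists c.
    have D' := dec c' e cj'; have n1 := no c' cj'.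
    have l : c' < c.
      rewrite ltnNge leq_eqVlt; apply/negP => /orP[/eqP X|X]; first by rewrite X in E'; lia.
      by have := inc _ _ e.+1 X cj'; lia.
    by have := inc _ _ e l cj; lia.
- have := bd c e cj; rewrite /swap; case: ifP => // _; do ?case: eqP; lia.
Qed.

(** * Scores and jeu de taquin moves *)

Definition wt (Q : nat -> nat -> bool) (o : option nat) (a : nat) : nat :=
  if o is Some e then Q e a else 0.

Definition weight b B (f : nat -> nat -> option nat) Q : nat :=
  \sum_(a < b) \sum_(c < B) wt Q (f a c) a.

Lemma leq_sum_pair n i i' (F H : nat -> nat) : i < n -> i' < n -> i != i' ->
  (forall a, a < n -> a != i -> a != i' -> F a <= H a) ->
  F i + F i' <= H i + H i' ->
  \sum_(a < n) F a <= \sum_(a < n) H a.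
Proof.
move=> i_n i_n' ne le le2.
rewrite !(bigD1 (Ordinal i_n) (P := xpredT)) //=.
rewrite !(bigD1 (Ordinal i_n') (P := fun a => a != Ordinal i_n)) //=; last first.
- by rewrite -val_eqE /= eq_sym.
- by rewrite -val_eqE /= eq_sym.
rewrite !addnA leq_add //; apply: leq_sum => a /andP[x y].
by apply: le.
Qed.

(** In passing from [f] to [f'], maximal scores do not drop under any time bound [n], the scores
    over all entries do not grow, and entries only move up. The second clause has no time bound
    because the exchange behind it may trade an entry for a larger one. *)
Definition dominates b B (f f' : nat -> nat -> option nat) : Prop :=
  [/\ forall n j pos, particles b j pos -> exists2 pos', particles b j pos' &
        weight b B f (fun e a => (e <= n) && occ j pos e a)
        <= weight b B f' (fun e a => (e <= n) && occ j pos' e a),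
      forall j pos, particles b j pos -> exists2 pos', particles b j pos' &
        weight b B f' (occ j pos) <= weight b B f (occ j pos')
    & forall Q : nat -> nat -> bool, (forall e a, Q e a.+1 -> Q e a) ->
        weight b B f Q <= weight b B f' Q].

Lemma dominates_refl b B f f' : (forall a c, f' a c = f a c) -> dominates b B f f'.
Proof.
move=> E; have W Q : weight b B f' Q = weight b B f Q.
  by apply: eq_bigr => a _; apply: eq_bigr => c _; rewrite E.
by split=> [n j pos|j pos|Q] ?; rewrite ?W //; exists pos; rewrite ?W.
Qed.

Lemma dominates_trans b B f g h :
  dominates b B f g -> dominates b B g h -> dominates b B f h.
Proof.
case=> A1 A2 A3 [B1 B2 B3]; split=> [n j pos F|j pos F|Q mQ].
- have [p1 F1 L1] := A1 n j pos F; have [p2 F2 L2] := B1 n j p1 F1.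
  by exists p2 => //; apply: leq_trans L2.
- have [p1 F1 L1] := B2 j pos F; have [p2 F2 L2] := A2 j p1 F1.
  by exists p2 => //; apply: leq_trans L2.
- exact: leq_trans (A3 Q mQ) (B3 Q mQ).
Qed.

Definition move (f : nat -> nat -> option nat) i j i' j' a c :=
  if (a == i) && (c == j) then f i' j'
  else if (a == i') && (c == j') then None else f a c.

Lemma move_right_dominates b B f i j : i < b -> j.+1 < B -> f i j = None ->
  dominates b B f (move f i j i j.+1).
Proof.
move=> ib jB hole.
have W Q : weight b B (move f i j i j.+1) Q = weight b B f Q.
  apply: eq_bigr => a _; have [E|ne] := eqVneq (nat_of_ord a) i; last first.
    by apply: eq_bigr => c _; rewrite /move (negPf ne).
  pose F c := wt Q (move f i j i j.+1 a c) a; pose H c := wt Q (f a c) a.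
  have same c : c != j -> c != j.+1 -> F c = H c.
    by move=> c1 c2; rewrite /F /move (negPf c1) (negPf c2) !andbF.
  have pair : F j + F j.+1 = H j + H j.+1.
    by rewrite /F /H /move E !eqxx /= gtn_eqF // hole addnC.
  apply/eqP; rewrite eqn_leq; apply/andP; split.
    by apply: (@leq_sum_pair B j j.+1 F H); rewrite ?pair //; [lia|lia|move=> c _ c1 c2; rewrite same].
  by apply: (@leq_sum_pair B j j.+1 H F); rewrite ?pair //; [lia|lia|move=> c _ c1 c2; rewrite same].
by split=> [n k pos|k pos|Q] ?; rewrite ?W //; exists pos; rewrite ?W.
Qed.

(** * Exchanging two rows along an upward move *)

Definition run_before (P : pred nat) p e := (e <= p) && all P (iota e (p.+1 - e)).
Definition run_after (P : pred nat) p e := (p <= e) && all P (iota p (e.+1 - p)).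

Lemma run_beforeP (P : pred nat) p e :
  reflect (e <= p /\ forall x, e <= x <= p -> P x) (run_before P p e).
Proof.
apply: (iffP andP) => -[ep H]; split=> //.
  by move=> x xp; move/allP: H; apply; rewrite mem_iota; lia.
by apply/allP => x; rewrite mem_iota => xp; apply: H; lia.
Qed.

Lemma run_afterP (P : pred nat) p e :
  reflect (p <= e /\ forall x, p <= x <= e -> P x) (run_after P p e).
Proof.
apply: (iffP andP) => -[ep H]; split=> //.
  by move=> x xp; move/allP: H; apply; rewrite mem_iota; lia.
by apply/allP => x; rewrite mem_iota => xp; apply: H; lia.
Qed.

(** In rows [i] and [i.+1], the columns left of the hole hold entries below [p], and those right of
    it entries above [p]. Hence changing a family only after [p], or only before [p], affects one
    side only. *)
Record up_move (b B : nat) (f : nat -> nat -> option nat) (i j p : nat) : Prop := UpMove {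
  up_row : i.+1 < b;
  up_col : j < B;
  up_hole : f i j = None;
  up_cell : f i.+1 j = Some p;
  up_left : forall c x, c < j -> f i c = Some x ->
              exists y, [/\ f i.+1 c = Some y, x < y & y < p];
  up_left' : forall c y, c < j -> f i.+1 c = Some y -> y < p;
  up_right : forall c y, j < c -> f i.+1 c = Some y ->
              exists x, [/\ f i c = Some x, p < x & x < y];
  up_right' : forall c x, j < c -> f i c = Some x -> p < x }.

(** Summing by columns reduces the comparison to the rows [i] and [i.+1], and in the column of the
    hole to the single entry [p]. *)
Lemma weight_move_up b B f i j p (Q Q' : nat -> nat -> bool) : up_move b B f i j p ->
  (forall e a, a != i -> a != i.+1 -> Q e a = Q' e a) ->
  (forall c, c < B -> c != j ->
     wt Q (f i c) i + wt Q (f i.+1 c) i.+1 <= wt Q' (f i c) i + wt Q' (f i.+1 c) i.+1) ->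
  Q p i.+1 <= Q' p i ->
  weight b B f Q <= weight b B (move f i j i.+1 j) Q'.
Proof.
move=> [ib jB hole cellp _ _ _ _] same cols last; rewrite /weight exchange_big [leqRHS]exchange_big /=.
apply: leq_sum => c _.
apply: (@leq_sum_pair b i i.+1 (fun a => wt Q (f a c) a)
   (fun a => wt Q' (move f i j i.+1 j a c) a)); try lia.
- move=> a _ ai ai1; rewrite /move (negPf ai) (negPf ai1) /=.
  by case: (f a c) => //= e; rewrite same.
- rewrite /move !eqxx /= (gtn_eqF (ltnSn i)) /=; case: eqP => [->|/eqP cj].
    by rewrite hole cellp /= addn0.
  by rewrite andbF; apply: cols.
Qed.

Lemma weight_move_up_rev b B f i j p (Q Q' : nat -> nat -> bool) : up_move b B f i j p ->
  (forall e a, a != i -> a != i.+1 -> Q e a = Q' e a) ->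
  (forall c, c < B -> c != j ->
     wt Q (f i c) i + wt Q (f i.+1 c) i.+1 <= wt Q' (f i c) i + wt Q' (f i.+1 c) i.+1) ->
  Q p i <= Q' p i.+1 ->
  weight b B (move f i j i.+1 j) Q <= weight b B f Q'.
Proof.
move=> [ib jB hole cellp _ _ _ _] same cols last; rewrite /weight exchange_big [leqRHS]exchange_big /=.
apply: leq_sum => c _.
apply: (@leq_sum_pair b i i.+1
   (fun a => wt Q (move f i j i.+1 j a c) a) (fun a => wt Q' (f a c) a)); try lia.
- move=> a _ ai ai1; rewrite /move (negPf ai) (negPf ai1) /=.
  by case: (f a c) => //= e; rewrite same.
- rewrite /move !eqxx /= (gtn_eqF (ltnSn i)) /=; case: eqP => [->|/eqP cj].
    by rewrite hole cellp /= addn0.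
  by rewrite andbF; apply: cols.
Qed.

Lemma swap_l i : swap i i = i.+1. Proof. by rewrite /swap eqxx. Qed.
Lemma swap_r i : swap i i.+1 = i. Proof. by rewrite /swap eqxx gtn_eqF. Qed.
Lemma swap_o i a : a != i -> a != i.+1 -> swap i a = a.
Proof. by rewrite /swap => /negPf -> /negPf ->. Qed.

Lemma move_up_dominates b B f i j p : up_move b B f i j p ->
  dominates b B f (move f i j i.+1 j).
Proof.
move=> U; have [ib jB hole cellp left left' right right'] := U.
split=> [n k pos F|k pos F|Q mQ].
(* The particle of row [i.+1] is raised from time [p] on, for as long as row [i] stays free. *)
- set low := only k pos i.+1 i; set run := run_after low p.
  exists (flip i run pos).
    apply: particles_flip_up => // [e /run_afterP[pe]|e /run_afterP[pe H] /run_afterP H'].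
      by apply; rewrite pe leqnn.
    apply/negP => lo; apply: H'; split=> [|x /andP[px xe]]; first lia.
    by have [->//|xe'] := eqVneq x e.+1; apply: H; lia.
  apply: (weight_move_up U) => [e a ai ai1|c cB cj|].
  + by rewrite occ_flip swap_o // if_same.
  + have {cj} [cj|cj] : c < j \/ j < c by lia.
      have E e a : e < p -> occ k (flip i run pos) e a = occ k pos e a.
        by move=> ep; rewrite occ_flip /run /run_after leqNgt ep.
      apply: leq_add.
        case H: (f i c) => [x|//] /=; have [y [_ xy yp]] := left _ _ cj H.
        by rewrite E //; lia.
      case H: (f i.+1 c) => [y|//] /=; have yp := left' _ _ cj H.
      by rewrite E.
    have lowN e : run e -> (occ k pos e i = false) /\ occ k pos e i.+1.
      by move=> /run_afterP[pe /(_ e)]; rewrite pe leqnn => /(_ isT)/andP[-> /negPf->].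
    case H: (f i.+1 c) => [y|] /=.
      (* If the run contains [y], it contains [x], because [p < x < y]. So whenever [y] is lost in
         the lower row, [x] is gained in the upper one, and [y <= n] gives [x <= n]. *)
      have [x [Hx px xy]] := right _ _ cj H; rewrite Hx /= !occ_flip swap_l swap_r.
      case: (boolP (run y)) => ry.
        have rx : run x.
          move/run_afterP: ry => [py ry]; apply/run_afterP; split=> [|z zz]; first lia.
          by apply: ry; lia.
        rewrite rx; have [-> ->] := lowN _ rx; have [-> ->] := lowN _ ry.
        rewrite !andbF !andbT; case: leqP => //=; case: leqP => //=; lia.
      by case: (boolP (run x)) => // rx; have [-> ->] := lowN _ rx; rewrite andbF leq_add.
    rewrite !addn0; case Hx: (f i c) => [x|//] /=; rewrite occ_flip swap_l.
    by case: (boolP (run x)) => // rx; have [-> ->] := lowN _ rx; rewrite andbF.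
  + rewrite occ_flip swap_l; case: ifP => // nr; case: (p <= n) => //=.
    move/negP: nr => nr; case: (boolP (occ k pos p i)) => [_|h1]; first by case: (occ _ _ _ _).
    case: (boolP (occ k pos p i.+1)) => // h2.
    case: nr; apply/run_afterP; split=> // x /andP[x1 x2].
    have -> : x = p by lia.
    by rewrite /low /only h2 h1.
(* Conversely, the particle of row [i] is lowered up to time [p], for the maximal run ending
   there. *)
- set high := only k pos i i.+1; set run := run_before high p.
  exists (flip i run pos).
    apply: particles_flip_down => // [e /run_beforeP[pe]|e /run_beforeP[pe H] /run_beforeP H'].
      by apply; rewrite pe leqnn.
    apply/negP => lo; apply: H'; split=> [|x /andP[px xe]]; first lia.
    by have [->//|xe'] := eqVneq x e; apply: H; lia.
  apply: (weight_move_up_rev U) => [e a ai ai1|c cB cj|].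
  + by rewrite occ_flip swap_o // if_same.
  + have {cj} [cj|cj] : c < j \/ j < c by lia.
      have highN e : run e -> (occ k pos e i.+1 = false) /\ occ k pos e i.
        by move=> /run_beforeP[pe /(_ e)]; rewrite pe leqnn => /(_ isT)/andP[-> /negPf->].
      case H: (f i c) => [x|] /=.
        (* If the run contains [x], it contains [y], because [x < y < p]: the lost [x] is replaced
           by the larger [y]. *)
        have [y [Hy xy yp]] := left _ _ cj H; rewrite Hy /= !occ_flip swap_l swap_r.
        case: (boolP (run x)) => rx.
          have ry : run y.
            move/run_beforeP: rx => [xp rx]; apply/run_beforeP; split=> [|z zz]; first lia.
            by apply: rx; lia.
          by rewrite ry; have [-> ->] := highN _ rx; have [-> ->] := highN _ ry.
        by case: (boolP (run y)) => // ry; have [-> ->] := highN _ ry; rewrite leq_add.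
      rewrite !add0n; case Hy: (f i.+1 c) => [y|//] /=; rewrite occ_flip swap_r.
      by case: (boolP (run y)) => // ry; have [-> ->] := highN _ ry.
    have E e a : p < e -> occ k (flip i run pos) e a = occ k pos e a.
      by move=> ep; rewrite occ_flip /run /run_before leqNgt ep.
    apply: leq_add.
      by case H: (f i c) => [x|//] /=; rewrite E //; apply: right' H.
    case H: (f i.+1 c) => [y|//] /=; have [x [_ px xy]] := right _ _ cj H.
    by rewrite E //; lia.
  + rewrite occ_flip swap_r; case: ifP => // /negP nr.
    case: (boolP (occ k pos p i.+1)) => [_|h1]; first by case: (occ _ _ _ _).
    case: (boolP (occ k pos p i)) => // h2.
    case: nr; apply/run_beforeP; split=> // x /andP[x1 x2].
    have -> : x = p by lia.
    by rewrite /high /only h2 h1.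
- by apply: (weight_move_up U) => //; case: (boolP (Q p i.+1)) => // /mQ ->.
Qed.

(** * Slides and rectification *)

Definition len (G : grid) a := size (nth [::] G a).

Lemma len_gt0_size G a j : j < len G a -> a < size G.
Proof. by rewrite /len; case: (ltnP a (size G)) => // /(nth_default _) ->. Qed.

Lemma some_pairE (i j a c : nat) :
  (Some (i, j) == Some (a, c)) = (i == a) && (j == c).
Proof. by apply/eqP/andP => [[-> ->]|[/eqP -> /eqP ->]]. Qed.

Lemma cell_set_cell G i j v a c :
  cell (set_cell G i j v) a c = if (a == i) && (c == j) then v else cell G a c.
Proof.
rewrite /cell /set_cell nth_set_nth /=; have [->|] //= := eqVneq a i.
by rewrite nth_set_nth /=; case: eqP.
Qed.

Lemma len_set_cell G i j v a : j < len G i -> len (set_cell G i j v) a = len G a.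
Proof.
move=> ji; rewrite /len /set_cell nth_set_nth /=; have [->|] //= := eqVneq a i.
by rewrite size_set_nth; apply/maxn_idPr.
Qed.

Lemma size_set_cell G i j v : j < len G i -> size (set_cell G i j v) = size G.
Proof. by move=> /len_gt0_size ji; rewrite size_set_nth; apply/maxn_idPr. Qed.

Lemma len_set_nth_take G i j a : j <= len G i ->
  len (set_nth [::] G i (take j (nth [::] G i))) a = if a == i then j else len G a.
Proof.
by move=> ji; rewrite /len nth_set_nth /=; case: eqP => // _; rewrite size_takel.
Qed.

(* [G] is a skew tableau whose inner shape is [mu], except that the cell [o],
   if any, is empty. *)
Record skew_grid (G : grid) (mu : nat -> nat) (o : option (nat * nat)) : Prop := SkewGrid {
  mu_le : forall a a', a <= a' -> mu a' <= mu a;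
  len_le : forall a a', a <= a' -> len G a' <= len G a;
  mu_len : forall a, mu a <= len G a;
  hole_in : forall i j, o = Some (i, j) -> mu i <= j < len G i;
  filled : forall a c, isSome (cell G a c) = (mu a <= c < len G a) && (o != Some (a, c));
  cell_mono : forall a a' c c' x y, a <= a' -> c <= c' ->
    cell G a c = Some x -> cell G a' c' = Some y -> x <= y;
  cell_inj : forall a a' c c' x, cell G a c = Some x -> cell G a' c' = Some x ->
    a = a' /\ c = c' }.

Lemma cell_ltn G mu o a a' c c' x y : skew_grid G mu o ->
  a <= a' -> c <= c' -> (a != a') || (c != c') ->
  cell G a c = Some x -> cell G a' c' = Some y -> x < y.
Proof.
move=> S aa cc ne X Y; rewrite ltn_neqAle (cell_mono S aa cc X Y) andbT.
apply/eqP => E; rewrite E in X; have [E1 E2] := cell_inj S X Y.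
by rewrite E1 E2 !eqxx in ne.
Qed.

Lemma filled_ex G mu o a c : skew_grid G mu o -> mu a <= c < len G a -> o != Some (a, c) ->
  exists x, cell G a c = Some x.
Proof.
move=> S H1 H2; have := filled S a c; rewrite H1 H2.
by case: (cell G a c) => // x _; exists x.
Qed.

Lemma filled_in G mu o a c x : skew_grid G mu o -> cell G a c = Some x ->
  mu a <= c < len G a /\ o != Some (a, c).
Proof. by move=> S X; apply/andP; rewrite -(filled S) X. Qed.

(** * One move of the hole *)

Section Move.
Variables (G : grid) (mu : nat -> nat) (i j : nat).
Hypothesis S : skew_grid G mu (Some (i, j)).

Lemma hole_empty : cell G i j = None.
Proof. by have := filled S i j; rewrite eqxx andbF; case: cell. Qed.

Let mu_ij : mu i <= j. Proof. by case/andP: (hole_in S erefl). Qed.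
Let len_ij : j < len G i. Proof. by case/andP: (hole_in S erefl). Qed.

Lemma hole_ne a c : (a != i) || (c != j) -> Some (i, j) != Some (a, c).
Proof.
by move=> ne; apply/eqP => -[E1 E2]; rewrite E1 E2 !eqxx in ne.
Qed.

(** This serves both directions of motion: the two bounds on [v] are the order conditions at its new
    position, and pairs of other cells keep their order. *)
Lemma skew_grid_move i' j' v (G' := set_cell (set_cell G i j (Some v)) i' j' None) :
  cell G i' j' = Some v ->
  (forall a c y, i <= a -> j <= c -> cell G a c = Some y -> v <= y) ->
  (forall a c y, a <= i -> c <= j -> cell G a c = Some y -> y <= v) ->
  [/\ skew_grid G' mu (Some (i', j')), size G' = size G,
      forall a, len G' a = len G a
    & forall a c, cell G' a c = move (cell G) i j i' j' a c].
Proof.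
move=> V ge le; have [/andP[mu' len']] := filled_in S V.
rewrite some_pairE negb_and => ne.
have len1 : j' < len (set_cell G i j (Some v)) i' by rewrite len_set_cell.
have lenE a : len G' a = len G a by rewrite /G' !len_set_cell.
have cellE a c : cell G' a c = move (cell G) i j i' j' a c.
  rewrite /G' !cell_set_cell /move V.
  case: (eqVneq a i) => [->|] //=; case: (eqVneq c j) => [->|] //=.
  by case/orP: ne => /negPf->; rewrite ?andbF.
split=> //; last by rewrite /G' !size_set_cell.
split=> //.
- exact: mu_le S.
- by move=> a a' /(len_le S); rewrite !lenE.
- by move=> a; rewrite lenE; exact: mu_len S a.
- by move=> _ _ [<- <-]; rewrite lenE mu'.
- move=> a c; rewrite lenE cellE /move V some_pairE.
  case: (eqVneq a i) => [->|ai] /=; case: (eqVneq c j) => [->|cj] /=.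
  + by rewrite mu_ij len_ij negb_and (eq_sym i') (eq_sym j') ne.
  + case: ifP => [/andP[/eqP <- /eqP <-]|E]; first by rewrite !eqxx andbF.
    by rewrite (filled S) hole_ne ?cj ?orbT // (eq_sym i') (eq_sym j') E.
  + case: ifP => [/andP[/eqP <- /eqP <-]|E]; first by rewrite !eqxx andbF.
    by rewrite (filled S) hole_ne ?ai // (eq_sym i') (eq_sym j') E.
  + case: ifP => [/andP[/eqP <- /eqP <-]|E]; first by rewrite !eqxx andbF.
    by rewrite (filled S) hole_ne ?ai // (eq_sym i') (eq_sym j') E.
- move=> a a' c c' x y aa cc; rewrite !cellE /move V.
  case: ifP => [/andP[/eqP ai /eqP cj] [<-]|_].
    case: ifP => [_ [<-] //|_]; case: ifP => // _; apply: ge; lia.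
  case: ifP => // _ X; case: ifP => [/andP[/eqP ai /eqP cj] [<-]|_].
    by apply: le X; lia.
  by case: ifP => // _; exact: (cell_mono S aa cc X).
- move=> a a' c c' x; rewrite !cellE /move V.
  case: ifP => [/andP[/eqP -> /eqP ->] [<-]|_].
    case: ifP => [/andP[/eqP -> /eqP ->] //|_]; case: ifP => // /andP no X; case: no.
    by have [-> ->] := cell_inj S X V.
  case: ifP => // /andP no X; case: ifP => [/andP[/eqP -> /eqP ->] [E]|_].
    by case: no; rewrite -E in X; have [-> ->] := cell_inj S X V.
  by case: ifP => // _; apply: (cell_inj S).
Qed.

Lemma skew_grid_right x (G' := set_cell (set_cell G i j (Some x)) i j.+1 None) :
  cell G i j.+1 = Some x ->
  (forall y, cell G i.+1 j = Some y -> x < y) ->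
  [/\ skew_grid G' mu (Some (i, j.+1)), size G' = size G,
      forall a, len G' a = len G a
    & forall a c, cell G' a c = move (cell G) i j i j.+1 a c].
Proof.
move=> X below; apply: skew_grid_move => // [a c y ia jc Y|a c y ia jc Y]; last first.
  by apply: (cell_mono S _ _ Y X) => //; apply: leqW.
have [cj|jc'] := leqP c j; last exact: (cell_mono S ia jc' X Y).
have {cj jc}E : c = j by lia.
subst c; have [ai|ai] := eqVneq a i; first by rewrite ai hole_empty in Y.
have [/andP[_ la] _] := filled_in S Y.
have ia' : i < a by rewrite ltn_neqAle eq_sym ai.
(* An entry further down column [j] forces the cell just below the hole to be filled; its entry lies
   between [x] and [y]. *)
have [z Z] : exists z, cell G i.+1 j = Some z.
  apply: (filled_ex S); last by apply: hole_ne; lia.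
  by rewrite (leq_trans _ mu_ij) ?(mu_le S) // (leq_trans la) // (len_le S).
by apply: leq_trans (cell_mono S ia' (leqnn j) Z Y); apply/ltnW/below.
Qed.

Lemma skew_grid_up b B p (G' := set_cell (set_cell G i j (Some p)) i.+1 j None) :
  size G = b -> len G 0 <= B ->
  cell G i.+1 j = Some p ->
  (forall x, cell G i j.+1 = Some x -> p <= x) ->
  [/\ skew_grid G' mu (Some (i.+1, j)), size G' = size G,
      forall a, len G' a = len G a,
      forall a c, cell G' a c = move (cell G) i j i.+1 j a c
    & up_move b B (cell G) i j p].
Proof.
move=> sb lB P right.
have [/andP[_ lp] _] := filled_in S P.
have rightx c x : j < c -> cell G i c = Some x ->
    exists z, [/\ cell G i j.+1 = Some z, p < z & z <= x].
  move=> jc X; have [/andP[_ lx] _] := filled_in S X.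
  have [z Z] : exists z, cell G i j.+1 = Some z.
    apply: (filled_ex S); last by apply: hole_ne; lia.
    by rewrite leqW //= (leq_trans _ lx).
  exists z; split=> //; last exact: (cell_mono S (leqnn i) jc Z X).
  rewrite ltn_neqAle right // andbT; apply/eqP => E; rewrite -E in Z.
  by have [] := cell_inj S P Z; lia.
have [] : [/\ skew_grid G' mu (Some (i.+1, j)), size G' = size G,
      forall a, len G' a = len G a
    & forall a c, cell G' a c = move (cell G) i j i.+1 j a c].
  apply: skew_grid_move => // [a c y ia jc Y|a c y ia jc Y]; last first.
    by apply: (cell_mono S _ _ Y P) => //; apply: leqW.
  have [ai|ia'] := leqP a i; last exact: (cell_mono S ia' jc P Y).
  have {ai ia}E : a = i by lia.
  subst a; have [cj|cj] := eqVneq c j; first by rewrite cj hole_empty in Y.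
  have jc' : j < c by rewrite ltn_neqAle eq_sym cj.
  by have [z [_ pz zy]] := rightx c y jc' Y; apply: leq_trans zy; apply: ltnW.
split=> //; split.
- by rewrite -sb; apply: len_gt0_size lp.
- by apply: leq_trans len_ij (leq_trans _ lB); apply: (len_le S).
- exact: hole_empty.
- by [].
- move=> c x cj X; have [/andP[mx _] _] := filled_in S X.
  have [y Y] : exists y, cell G i.+1 c = Some y.
    apply: (filled_ex S); last by apply: hole_ne; lia.
    by rewrite (leq_trans _ mx) ?(mu_le S) // (ltn_trans cj).
  exists y; split=> //; first by apply: (cell_ltn S _ _ _ X Y) => //; rewrite ltn_eqF.
  by apply: (cell_ltn S _ _ _ Y P) => //; rewrite ?(ltnW cj) // (ltn_eqF cj) orbT.
- move=> c y cj Y.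
  by apply: (cell_ltn S _ _ _ Y P) => //; rewrite ?(ltnW cj) // (ltn_eqF cj) orbT.
- move=> c y jc Y; have [/andP[_ ly] _] := filled_in S Y.
  have [x X] : exists x, cell G i c = Some x.
    apply: (filled_ex S); last by apply: hole_ne; lia.
    rewrite (leq_trans mu_ij) ?(ltnW jc) //= (leq_trans ly) //.
    exact: (len_le S).
  exists x; split=> //; last by apply: (cell_ltn S _ _ _ X Y) => //; rewrite ltn_eqF.
  by have [z [_ pz zx]] := rightx c x jc X; apply: leq_trans zx.
- move=> c x jc X.
  by have [z [_ pz zx]] := rightx c x jc X; apply: leq_trans zx.
Qed.

(** A hole without right and lower neighbours is the last cell of its row, and the next row has
    length at most [j]. So truncation removes the hole alone and leaves a skew shape. *)
Lemma skew_grid_end (G' := set_nth [::] G i (take j (nth [::] G i))) :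
  cell G i j.+1 = None -> cell G i.+1 j = None ->
  [/\ skew_grid G' mu None, size G' = size G, forall a, len G' a <= len G a
    & forall a c, cell G' a c = cell G a c].
Proof.
move=> R D.
have lenE a : len G' a = if a == i then j else len G a.
  by rewrite len_set_nth_take // ltnW.
have lenj : len G i = j.+1.
  apply/eqP; rewrite eqn_leq len_ij andbT leqNgt; apply/negP => l.
  by have [||x] := filled_ex (a := i) (c := j.+1) S; rewrite ?R ?l ?leqW //; apply: hole_ne; lia.
have lenS : len G i.+1 <= j.
  rewrite leqNgt; apply/negP => l.
  have [||x] := filled_ex (a := i.+1) (c := j) S; rewrite ?D //; last by apply: hole_ne; lia.
  by rewrite l (leq_trans _ mu_ij) // (mu_le S).
have cellE a c : cell G' a c = cell G a c.
  rewrite /cell /G' nth_set_nth /=; have [->|] //= := eqVneq a i.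
  have [cj|jc] := ltnP c j; first by rewrite nth_take.
  rewrite nth_default ?size_takel ?(ltnW len_ij) //.
  have := filled S i c; rewrite lenj /cell.
  have [->|cj] := eqVneq c j; first by rewrite eqxx andbF; case: nth.
  have -> : (c < j.+1) = false by lia.
  by rewrite andbF; case: nth.
split=> //; last first.
- by move=> a; rewrite lenE; case: eqP => // ->; apply: ltnW.
- rewrite /G' size_set_nth; apply/maxn_idPr; exact: len_gt0_size len_ij.
split=> //.
- exact: mu_le S.
- move=> a a' aa; rewrite !lenE; have [E|n] := eqVneq a i; have [E'|n'] := eqVneq a' i => //.
  + by apply: leq_trans lenS; apply: (len_le S); lia.
  + have lij := len_ij; rewrite -E' in lij.
    exact: leq_trans (ltnW lij) (len_le S aa).
  + exact: (len_le S).
- by move=> a; rewrite lenE; case: eqP => [->//|_]; exact: mu_len S a.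
- move=> a c; rewrite cellE (filled S) lenE some_pairE andbT.
  have [->|n] := eqVneq a i; rewrite ?lenj /=; last by rewrite andbT.
  lia.
- by move=> a a' c c' x y aa cc; rewrite !cellE; apply: (cell_mono S).
- by move=> a a' c c' x; rewrite !cellE; apply: (cell_inj S).
Qed.

End Move.

(** Each move of the hole lowers [(b - i) + (len G 0 - j)] by one, so the fuel suffices; the
    dominations of the single moves compose. *)
Lemma slide_fromP b B mu fuel G i j : skew_grid G mu (Some (i, j)) ->
  size G = b -> len G 0 <= B -> (b - i) + (len G 0 - j) <= fuel ->
  [/\ skew_grid (slide_from fuel G i j) mu None,
      size (slide_from fuel G i j) = b,
      len (slide_from fuel G i j) 0 <= len G 0
    & dominates b B (cell G) (cell (slide_from fuel G i j))].
Proof.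
elim: fuel G i j => [|fuel IH] G i j S sb lB fl.
  by have /andP[_ /len_gt0_size] := hole_in S erefl; lia.
have /andP[muj lij] := hole_in S erefl; have ib := len_gt0_size lij.
have l0 := len_le S (leq0n i); have ho := hole_empty S.
have right x : cell G i j.+1 = Some x ->
  (forall y, cell G i.+1 j = Some y -> x < y) ->
  let G' := slide_from fuel (set_cell (set_cell G i j (Some x)) i j.+1 None) i j.+1 in
  [/\ skew_grid G' mu None, size G' = b, len G' 0 <= len G 0
    & dominates b B (cell G) (cell G')].
  move=> X lt; have [S' s' l' c'] := skew_grid_right S X lt.
  have [/andP[_ lx] _] := filled_in S X.
  have [||| S2 s2 l2 d2] := IH _ _ _ S'; rewrite ?s' ?l' //; first by lia.
  split=> //; first by rewrite -(l' 0).
  apply: dominates_trans d2; apply: dominates_trans (dominates_refl _ _ c').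
  by apply: move_right_dominates ho; [rewrite -sb|lia].
have up p : cell G i.+1 j = Some p ->
  (forall x, cell G i j.+1 = Some x -> p <= x) ->
  let G' := slide_from fuel (set_cell (set_cell G i j (Some p)) i.+1 j None) i.+1 j in
  [/\ skew_grid G' mu None, size G' = b, len G' 0 <= len G 0
    & dominates b B (cell G) (cell G')].
  move=> P le; have [S' s' l' c' U] := skew_grid_up S sb lB P le.
  have [/andP[_ /len_gt0_size lx] _] := filled_in S P.
  have [||| S2 s2 l2 d2] := IH _ _ _ S'; rewrite ?s' ?l' //; first by lia.
  split=> //; first by rewrite -(l' 0).
  apply: dominates_trans d2; apply: dominates_trans (dominates_refl _ _ c').
  exact: move_up_dominates U.
rewrite /=; case X: (cell G i j.+1) => [x|]; case P: (cell G i.+1 j) => [p|].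
- case: ltnP => lt; first by apply: right => // y; rewrite P => -[<-].
  by apply: up => // y; rewrite X => -[<-].
- by apply: right => // y; rewrite P.
- by apply: up => // y; rewrite X.
- have [S' s' l' c'] := skew_grid_end S X P; split=> //; first by rewrite s'.
  exact: dominates_refl.
Qed.

(** * Rectification as a sequence of slides *)

Lemma find_isSome (T : Type) (s : seq (option T)) m : m <= size s ->
  (forall c, isSome (nth None s c) = (m <= c < size s)) -> find isSome s = m.
Proof.
move=> ms H; have [l|g] := ltnP m (size s).
  have h : has isSome s by apply/(has_nthP None); exists m; rewrite ?H ?leqnn.
  apply/eqP; rewrite eqn_leq; apply/andP; split.
    by rewrite leqNgt; apply/negP => /(before_find None); rewrite H leqnn l.
  by have := nth_find None h; rewrite H => /andP[].
have E : m = size s by lia.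
rewrite hasNfind //; apply/(has_nthP None) => -[c _]; rewrite H; lia.
Qed.

Lemma nlead_mu G mu a : skew_grid G mu None -> nlead (nth [::] G a) = mu a.
Proof.
move=> S; apply: find_isSome => [|c]; first exact: mu_len S a.
by have := filled S a c; rewrite andbT.
Qed.

Lemma sorted_last x0 (s : seq nat) y : sorted ltn s -> y \in s -> y <= last x0 s.
Proof.
move=> so ys; have sz : 0 < size s by case: s ys {so}.
rewrite -nth_last -{1}(nth_index x0 ys).
apply: (sorted_leq_nth leq_trans leqnn); rewrite ?inE.
- by apply: sub_sorted so => u v /ltnW.
- by rewrite index_mem.
- by rewrite prednK.
- by rewrite -ltnS prednK // index_mem.
Qed.

Lemma gsizeE G : gsize G = \sum_(a < size G) len G a.
Proof. by rewrite /gsize sumnE big_map (big_nth [::]) big_mkord. Qed.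

Lemma len_gsize G : len G 0 <= gsize G.
Proof. by case: G => //= row G; rewrite /gsize /= leq_addr. Qed.

(** Each slide removes one cell of the inner shape, whose size therefore bounds the number of
    slides. *)
Lemma rect_fuelP b B fuel G mu : skew_grid G mu None -> size G = b -> len G 0 <= B ->
  \sum_(a < b) mu a < fuel ->
  [/\ skew_grid (rect_fuel fuel G) (fun=> 0) None, size (rect_fuel fuel G) = b,
      len (rect_fuel fuel G) 0 <= len G 0
    & dominates b B (cell G) (cell (rect_fuel fuel G))].
Proof.
elim: fuel G mu => // fuel IH G mu S sb lB fl.
have nl a := nlead_mu a S; rewrite /=.
set cs := [seq i <- iota 0 (size G) | 0 < nlead (nth [::] G i)].
have csP a : (a \in cs) = (0 < mu a).
  rewrite mem_filter mem_iota nl add0n /=.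
  case: (posnP (mu a)) => //= pos; apply: (len_gt0_size (j := 0)).
  exact: leq_trans pos (mu_len S a).
have [E|ne] := eqVneq cs [::].
  rewrite E; have mu0 a : mu a = 0 by have := csP a; rewrite E in_nil; case: (mu a).
  split=> //; last exact: dominates_refl.
  case: S => H1 H2 H3 H4 H5 H6 H7; split=> // a c.
  by rewrite H5 mu0.
set i := last 0 cs.
have -> : match cs with [::] => G | _ :: _ => rect_fuel fuel (slide_from (gsize G + size G) G i (nlead (nth [::] G i)).-1) end
  = rect_fuel fuel (slide_from (gsize G + size G) G i (mu i).-1).
  by rewrite nl; case: (cs) ne.
have ics : i \in cs by rewrite /i; case: (cs) ne => // x s _; exact: mem_last.
have mui : 0 < mu i by rewrite -csP.
have mu_after a : i < a -> mu a = 0.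
  move=> ia; apply/eqP; rewrite -leqn0 leqNgt -csP; apply/negP => /(sorted_last 0).
  move/(_ (sorted_filter ltn_trans _ (iota_ltn_sorted _ _))); rewrite -/i; lia.
(* The chosen inner corner becomes a hole of a tableau with inner shape [mu'], no entry being
   touched. [mu'] still decreases because [mu] vanishes below row [i]. *)
pose mu' a := if a == i then (mu i).-1 else mu a.
have li := mu_len S i.
have S' : skew_grid G mu' (Some (i, (mu i).-1)).
  split.
  - move=> a a' aa; rewrite /mu'; have := mu_le S aa; have A := mu_after a'.
    case: (eqVneq a i) => E; case: (eqVneq a' i) => E'; rewrite ?E ?E' in aa A *; lia.
  - exact: len_le S.
  - by move=> a; have := mu_len S a; rewrite /mu'; case: eqP => [->|_]; lia.
  - by move=> _ _ [<- <-]; rewrite /mu' eqxx leqnn /=; lia.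
  - move=> a c; rewrite (filled S) andbT some_pairE /mu' (eq_sym i).
    case: eqP => [->|_] //=; last by rewrite andbT.
    lia.
  - exact: cell_mono S.
  - exact: cell_inj S.
have ib := len_gt0_size (leq_trans mui li).
have [|S2 s2 l2 d2] := @slide_fromP b B mu' (gsize G + size G) _ _ _ S' sb lB.
  by have := len_gsize G; lia.
have [||S3 s3 l3 d3] := IH _ mu' S2 s2.
- exact: leq_trans lB.
- rewrite -ltnS; apply: leq_trans fl.
  have ib' : i < b by rewrite -sb.
  rewrite ltnS (bigD1 (Ordinal ib')) // [leqRHS](bigD1 (Ordinal ib')) //= /mu' eqxx.
  rewrite -addSn prednK // leq_add2l; apply: leq_sum => a ai.
  by rewrite (negPf (ai : nat_of_ord a != i)).
- by split=> //; [exact: leq_trans l2|apply: dominates_trans d3].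
Qed.

(** * Computing scores *)

Definition cumul (d : nat -> nat -> nat) a n := \sum_(e < n.+1) d a e.

Section Particle.
Variables (d : nat -> nat -> nat) (M : nat -> nat) (pi : nat -> nat).
Local Notation N := (cumul d).

Let NS a n : N a n.+1 = N a n + d a n.+1. Proof. exact: big_ord_recr. Qed.

(** Compare the score up to time [n] with the number of entries [<= n] of the current row. A climb
    from row [y] to row [x] lowers the latter by at most the sum of [M i] over [x <= i < y]; adding
    these losses along the path gives [main]. *)
Lemma particle_upper c B n :
  (forall e, pi e.+1 <= pi e) -> (forall a n, N a.+1 n <= N a n + M a) ->
  c <= pi n -> pi 0 <= B ->
  \sum_(e < n.+1) d (pi e) e <= N c n + \sum_(c <= i < B) M i.
Proof.
move=> dec step cn B0.
have tele x y k : x <= y -> N y k <= N x k + \sum_(x <= i < y) M i.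
  elim: y => [|y IH] xy; first by move: xy; rewrite leqn0 => /eqP ->; rewrite leq_addr.
  have [->|ne] := eqVneq x y.+1; first by rewrite leq_addr.
  rewrite big_nat_recr /=; last by lia.
  by have := IH ltac:(lia); have := step y k; lia.
have pi0 k : pi k <= pi 0 by elim: k => // k IH; exact: leq_trans (dec k) IH.
have main : \sum_(e < n.+1) d (pi e) e <= N (pi n) n + \sum_(pi n <= i < pi 0) M i.
  elim: n {cn} => [|n IH]; first by rewrite /cumul !big_ord_recr !big_ord0 /= leq_addr.
  rewrite big_ord_recr NS /=.
  rewrite (big_cat_nat (dec n) (pi0 n)) /=.
  rewrite [leqRHS]addnAC leq_add2r addnA (leq_trans IH) // leq_add2r.
  exact: tele.
apply: leq_trans main _.
rewrite (big_cat_nat (leq_trans cn (pi0 n)) B0) /= (big_cat_nat cn (pi0 n)) /=.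
by rewrite !addnA (leq_trans _ (leq_addr _ _)) // leq_add2r; apply: tele.
Qed.

(** The upper bound is attained by a path that climbs one row at a time, always when the lower row
    leads by exactly [M]. *)
Lemma particle_eq n :
  (forall e, pi e.+1 = pi e \/
     pi e = (pi e.+1).+1 /\ N (pi e) e = N (pi e.+1) e + M (pi e.+1)) ->
  \sum_(e < n.+1) d (pi e) e = N (pi n) n + \sum_(pi n <= i < pi 0) M i.
Proof.
move=> step.
have dec e : pi e.+1 <= pi e by case: (step e) => [->//|[-> _]].
have pi0 k : pi k <= pi 0 by elim: k => // k IH; exact: leq_trans (dec k) IH.
elim: n => [|n IH]; first by rewrite /cumul big_geq // addn0 !big_ord_recr !big_ord0.
rewrite big_ord_recr NS /= IH.
case: (step n) => [->|[E1 E2]]; first by rewrite addnAC.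
have lt : pi n.+1 < pi 0 by rewrite -E1.
by rewrite E2 E1 [in RHS]big_ltn //; lia.
Qed.

End Particle.

Definition mult B (f : nat -> nat -> option nat) a e := \sum_(c < B) (f a c == Some e).
Definition row_count B f := cumul (mult B f).

Lemma sum_eq_Some n (o : option nat) (F : nat -> nat) :
  \sum_(e < n.+1) (o == Some (nat_of_ord e)) * F e = if o is Some x then (x <= n) * F x else 0.
Proof.
case: o => [x|]; last by rewrite big1.
have [xn|nx] := leqP x n.
  have xn' : x < n.+1 by [].
  rewrite (bigD1 (Ordinal xn')) //= eqxx big1 ?addn0 // => e ne.
  case: eqP => // -[E]; case/eqP: ne; exact: val_inj.
by rewrite big1 // => e _; case: eqP => // -[E]; have := ltn_ord e; lia.
Qed.

Lemma row_countE B f a n :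
  row_count B f a n = \sum_(c < B) wt (fun e _ => e <= n) (f a c) a.
Proof.
rewrite /row_count /cumul /mult exchange_big; apply: eq_bigr => c _ /=.
transitivity (\sum_(e < n.+1) (f a c == Some (nat_of_ord e)) * 1).
  by apply: eq_bigr => e _; rewrite muln1.
rewrite (sum_eq_Some n (f a c) (fun=> 1)); by case: (f a c) => // x; rewrite muln1.
Qed.

(** The particles occupy distinct rows, so exchanging sums splits the score into one sum along each
    path. *)
Lemma weight_occ b B f n j pos : particles b j pos ->
  weight b B f (fun e a => (e <= n) && occ j pos e a)
  = \sum_(c < j) \sum_(e < n.+1) mult B f (pos c e) e.
Proof.
move=> F; have [_ _ bd] := F.
transitivity (\sum_(a < b) \sum_(c < B) \sum_(e < n.+1)
   (f a c == Some (nat_of_ord e)) * \sum_(k < j) (pos k e == a)).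
  apply: eq_bigr => a _; apply: eq_bigr => c _.
  rewrite (sum_eq_Some n (f a c) (fun e => \sum_(k < j) (pos k e == a))).
  by case: (f a c) => //= e; rewrite -(occE e a F) mulnb.
rewrite [RHS]exchange_big /=.
under eq_bigr => a _ do rewrite exchange_big /=.
rewrite exchange_big /=; apply: eq_bigr => e _.
under eq_bigr => a _ do rewrite -big_distrl /= -/(mult B f a e) big_distrr /=.
rewrite exchange_big /=; apply: eq_bigr => k _.
rewrite (bigD1 (Ordinal (bd k e (ltn_ord k)))) //= eqxx muln1 big1 ?addn0 // => a ne.
by case: eqP => [E|]; rewrite ?muln0 //; case/eqP: ne; apply: val_inj; rewrite /= E.
Qed.

Lemma particles_const b j : j <= b -> particles b j (fun c _ => c).
Proof. by move=> jb; split=> // c _ cj; apply: leq_trans jb. Qed.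

Lemma occ_const j e a : occ j (fun c _ => c) e a = (a < j).
Proof. by apply/occP/idP => [[c cj <-]|aj]; last exists a. Qed.

(** In a straight shape every entry has one above it that is no larger. Thus [particle_upper]
    applies with [M = 0]: climbing gains nothing. *)
Lemma straight_row_count B G a n : skew_grid G (fun=> 0) None ->
  row_count B (cell G) a.+1 n <= row_count B (cell G) a n.
Proof.
move=> S; rewrite !row_countE; apply: leq_sum => c _.
case Y: (cell G a.+1 c) => [y|] //=.
have [/andP[_ ly] _] := filled_in S Y.
have [|x X] := @filled_ex _ _ _ a c S _ isT; first by rewrite (leq_trans ly) // (len_le S).
rewrite X /=; have := cell_mono S (leqnSn a) (leqnn c) X Y.
case: (leqP y n) => // yn xy; by rewrite (leq_trans xy yn).
Qed.

Lemma weight_mono b B f (Q Q' : nat -> nat -> bool) :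
  (forall a c e, a < b -> f a c = Some e -> Q e a -> Q' e a) ->
  weight b B f Q <= weight b B f Q'.
Proof.
move=> H; apply: leq_sum => a _; apply: leq_sum => c _.
case E: (f a c) => [e|] //=; case: (boolP (Q e a)) => // q.
by rewrite (H _ _ _ (ltn_ord a) E q).
Qed.

Lemma weight_add b B f (Q Q1 Q2 : nat -> nat -> bool) :
  (forall e a, Q e a = Q1 e a + Q2 e a :> nat) ->
  weight b B f Q = weight b B f Q1 + weight b B f Q2.
Proof.
move=> H; rewrite /weight -big_split; apply: eq_bigr => a _.
by rewrite -big_split; apply: eq_bigr => c _ /=; case: (f a c) => //= e; rewrite H.
Qed.

Lemma weight_gt0 b B f (Q : nat -> nat -> bool) : reflect (exists a c e, [/\ a < b, c < B, f a c = Some e & Q e a])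
  (0 < weight b B f Q).
Proof.
rewrite lt0n; apply: (iffP idP) => [|[a [c [e [ab cB E q]]]]].
  rewrite sum_nat_eq0 negb_forall => /existsP[a]; rewrite sum_nat_eq0 negb_forall => /existsP[c].
  rewrite /wt; case E: (f a c) => [e|] //=; case q: (Q e a) => // _.
  by exists a, c, e.
rewrite /weight (bigD1 (Ordinal ab)) //= (bigD1 (Ordinal cB)) //= E /= q.
by rewrite add1n addSn.
Qed.

Lemma sum_ord_ltn h s : s <= h -> \sum_(i < h) (i < s) = s.
Proof.
elim: h s => [|h IH] s sh; first by rewrite big_ord0; lia.
rewrite big_ord_recr /=; have [->|ne] := eqVneq s h.+1.
  rewrite ltnS leqnn; under eq_bigr => i _ do rewrite ltnS (ltnW (ltn_ord i)).
  by rewrite sum_nat_const card_ord; lia.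
by rewrite IH; lia.
Qed.

(** At most one term of the increasing [tau] equals [e], and then exactly the terms of smaller index
    lie below [e]. *)
Lemma count_below_step h (tau : nat -> nat) (cnt := fun e => \sum_(s < h) (tau s < e)) e :
  (forall s s', s < s' -> s' < h -> tau s < tau s') ->
  cnt e.+1 = cnt e \/ exists s, [/\ s < h, tau s = e, cnt e = s & cnt e.+1 = s.+1].
Proof.
move=> inc; case: (pickP (fun s : 'I_h => tau s == e)) => [s /eqP E|no].
  have cmp (s' : 'I_h) : (tau s' < e) = (s' < s) /\ (tau s' < e.+1) = (s' < s.+1).
    have := ltn_ord s; have := ltn_ord s'.
    case: (ltngtP s' s) => [l|l|/val_inj ->].
    - by have := inc _ _ l (ltn_ord s); lia.
    - by have := inc _ _ l (ltn_ord s'); lia.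
    - by rewrite E; lia.
  right; exists s; split=> //; rewrite /cnt.
    under eq_bigr => s' _ do rewrite (cmp s').1.
    by apply: sum_ord_ltn; exact: ltnW.
  under eq_bigr => s' _ do rewrite (cmp s').2.
  exact: sum_ord_ltn.
left; apply: eq_bigr => s _; have := no s; lia.
Qed.

(** This maximizes [v - u], stated additively. The index 0 has difference 0, so the search can be
    restricted to [u l <= v l], where truncated subtraction is exact. *)
Lemma argmax_diff (u v : nat -> nat) m : 0 < m -> u 0 = v 0 ->
  {t | [/\ t < m, u t <= v t & forall l, l < m -> v l + u t <= u l + v t]}.
Proof.
case: m => // m _ uv.
have P0 : u (@ord0 m) <= v (@ord0 m) by rewrite /= uv.
exists [arg max_(l > (@ord0 m) | u l <= v l) (v l - u l)].
case: arg_maxnP => // t ut tmax; split=> // l lm.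
have [ul|ul] := leqP (u l) (v l); last by lia.
by have := tmax (Ordinal lm) ul; rewrite /=; lia.
Qed.

(** * Rows made of shifted copies *)

Lemma size_row_power (w : seq nat) m k :
  size (flatten [seq [seq x + t * m | x <- w] | t <- iota 0 k]) = k * size w.
Proof.
rewrite size_flatten /shape -map_comp sumnE big_map.
under eq_bigr => t _ do rewrite /= size_map.
by rewrite big_const_seq count_predT size_iota iter_addn addn0 mulnC.
Qed.

Lemma nth_row_power (w : seq nat) m k p : p < k * size w ->
  nth 0 (flatten [seq [seq x + t * m | x <- w] | t <- iota 0 k]) p
  = nth 0 w (p %% size w) + p %/ size w * m.
Proof.
elim: k => // k IH; rewrite -{2}(addn1 k) iotaD map_cat flatten_cat /= cats0 add0n mulSn => pk.
rewrite nth_cat size_row_power; case: ltnP => [/IH //|kp].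
have E : p = k * size w + (p - k * size w) by lia.
have lt : p - k * size w < size w by lia.
rewrite (nth_map 0) // [in RHS]E divnMDl ?modnMDl; last by lia.
by rewrite modn_small // divn_small // addn0.
Qed.

Lemma sum_nth_None (F : option nat -> nat) (s : seq (option nat)) B : F None = 0 ->
  size s <= B -> \sum_(c < B) F (nth None s c) = \sum_(x <- s) F x.
Proof.
move=> F0; elim: s B => [|x s IH] B sB.
  by rewrite big_nil big1 // => c _; rewrite nth_nil.
case: B sB => // B sB; rewrite big_ord_recl big_cons /=; congr (_ + _).
exact: IH.
Qed.

(** Copies of index below [q] consist of letters [<= q * m], and those of index above [q] of letters
    beyond [q * m + l]; only copy [q] is cut, at [l]. *)
Lemma row_count_power_seq (w : seq nat) m k q l :
  l < m -> (forall x, x \in w -> 0 < x <= m) ->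
  \sum_(x <- flatten [seq [seq x + t * m | x <- w] | t <- iota 0 k]) (x <= q * m + l)
  = minn q k * size w + (q < k) * \sum_(x <- w) (x <= l).
Proof.
move=> lm wm; rewrite big_flatten big_map.
elim: k => [|k IH]; first by rewrite big_nil minn0.
rewrite -{1}(addn1 k) iotaD big_cat /= IH big_seq1 big_map add0n {IH}.
have term : \sum_(x <- w) (x + k * m <= q * m + l) =
    if k < q then size w else if k == q then \sum_(x <- w) (x <= l) else 0.
  have -> : size w = \sum_(x <- w) 1 by rewrite sum1_size.
  case: (ltngtP k q) => kq.
  - apply: eq_big_seq => x /wm /andP[_ xm].
    have : k.+1 * m <= q * m by rewrite leq_mul2r kq orbT.
    by rewrite mulSn; lia.
  - rewrite big_seq big1 // => x /wm /andP[x0 _].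
    have : q.+1 * m <= k * m by rewrite leq_mul2r kq orbT.
    by rewrite mulSn; lia.
  - by rewrite kq; apply: eq_bigr => x _; rewrite addnC leq_add2l.
rewrite term; case: (ltngtP k q) => kq.
- have -> : minn q k.+1 = k.+1 by lia.
  have -> : (q < k.+1) = false by lia.
  by rewrite !mul0n !addn0 mulSn addnC.
- have -> : minn q k.+1 = q by lia.
  have -> : q < k.+1 by lia.
  by rewrite addn0.
- rewrite kq ?ltnn ?ltnS leqnn ?minnn.
  have -> : minn q q.+1 = q by lia.
  by rewrite mul0n mul1n addn0.
Qed.

(** * The tableau S^(b) *)

Lemma nth_to_grid T a : size (offs T) = size (rows T) -> a < size (rows T) ->
  nth [::] (to_grid T) a
  = nseq (nth 0 (offs T) a) None ++ map Some (nth [::] (rows T) a).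
Proof.
move=> sz aT; rewrite /to_grid (nth_map (0, [::])) ?size_zip ?sz ?minnn //.
by rewrite nth_zip.
Qed.

Lemma cell_to_grid T a c : size (offs T) = size (rows T) -> a < size (rows T) ->
  cell (to_grid T) a c =
  if c < nth 0 (offs T) a then None
  else nth None (map Some (nth [::] (rows T) a)) (c - nth 0 (offs T) a).
Proof.
move=> sz aT; rewrite /cell nth_to_grid // nth_cat size_nseq.
by case: ifP => // _; rewrite nth_nseq if_same.
Qed.

Lemma uniq_flatten_nth (ss : seq (seq nat)) a a' x : uniq (flatten ss) ->
  x \in nth [::] ss a -> x \in nth [::] ss a' -> a = a'.
Proof.
have mem b (us : seq (seq nat)) : x \in nth [::] us b -> x \in flatten us.
  move=> xb; apply/flattenP; exists (nth [::] us b) => //.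
  by apply: mem_nth; rewrite ltnNge; apply/negP => /(nth_default _) E; rewrite E in xb.
elim: ss a a' => [|s ss IH] [|a] [|a'] //=; rewrite cat_uniq => /and3P[_ /hasPn no u] X Y.
- by have := no x (mem _ _ Y); rewrite X.
- by have := no x (mem _ _ X); rewrite Y.
- by rewrite (IH a a').
Qed.

Lemma sorted_geq_nth (s : seq nat) a a' : sorted geq s -> a <= a' -> nth 0 s a' <= nth 0 s a.
Proof.
move=> so aa; have [l|g] := ltnP a' (size s); last by rewrite (nth_default _ g).
have tr : transitive geq by move=> x y z /= xy yz; exact: leq_trans yz xy.
have rf : reflexive geq by move=> x /=.
by apply: (sorted_leq_nth tr rf 0 so) => //; rewrite inE // (leq_ltn_trans aa).
Qed.

Section Power.
Variables (b r : nat) (S : skew).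
Hypotheses (b0 : 0 < b) (r0 : 0 < r) (std : is_standard_skew S)
  (size_b : size (rows S) = b) (all_r : all (fun w => size w == r) (rows S)).

Local Notation m := (ncells S).
Local Notation w a := (nth [::] (rows S) a).
Local Notation o a := (nth 0 (offs S) a).
Local Notation G := (to_grid (skew_pow S b)).

Definition power_entry a p := nth 0 (w a) (p %% r) + p %/ r * m.

Let offs_size : size (offs S) = size (rows S). Proof. by case: std => -[]. Qed.

Let size_w a : a < b -> size (w a) = r.
Proof. by rewrite -size_b => ab; apply/eqP/(allP all_r); exact: mem_nth. Qed.

Let w_bounds a x : x \in w a -> 0 < x <= m.
Proof.
move=> xa; have [_ _ _ _ pe] := std.
have [ab|ba] := ltnP a b; last by rewrite nth_default ?size_b in xa.
have : x \in flatten (rows S).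
  by apply/flattenP; exists (w a) => //; apply: mem_nth; rewrite size_b.
by rewrite (perm_mem pe) mem_iota; lia.
Qed.

Let w_nth_bounds a s : a < b -> s < r -> 0 < nth 0 (w a) s <= m.
Proof. by move=> ab sr; apply: (w_bounds (a := a)); apply: mem_nth; rewrite size_w. Qed.

Lemma ncells_gt0 : 0 < m.
Proof. by have := w_nth_bounds b0 r0; lia. Qed.

Let w_sorted a : sorted ltn (w a).
Proof.
have [_ _ so _ _] := std; have [ab|ba] := ltnP a b; last by rewrite nth_default // size_b.
by apply: (allP so); apply: mem_nth; rewrite size_b.
Qed.

Let w_ltn a s s' : a < b -> s < s' -> s' < r -> nth 0 (w a) s < nth 0 (w a) s'.
Proof.
move=> ab ss sr; apply: (sorted_ltn_nth ltn_trans 0 (w_sorted a)) => //;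
  rewrite inE size_w //; exact: ltn_trans ss sr.
Qed.

Let w_col a s : a.+1 < b -> s + (o a - o a.+1) < r ->
  nth 0 (w a) s < nth 0 (w a.+1) (s + (o a - o a.+1)).
Proof.
move=> ab sd; have [[_ so] _ _ col _] := std.
have le := sorted_geq_nth so (leqnSn a).
apply: (col a (o a + s)).
- rewrite (cell_to_grid _ offs_size) ?size_b ?(ltnW ab) // ltnNge leq_addr /= addKn.
  by rewrite (nth_map 0) // size_w ?(ltnW ab) //; lia.
- rewrite (cell_to_grid _ offs_size) ?size_b // ltnNge (leq_trans le (leq_addr _ _)) /=.
  have -> : o a + s - o a.+1 = s + (o a - o a.+1) by lia.
  by rewrite (nth_map 0) // size_w.
Qed.

Let nth_rows_pow a : a < b -> nth [::] (rows (skew_pow S b)) a =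
  flatten [seq [seq x + t * m | x <- w a] | t <- iota 0 b].
Proof. by move=> ab; rewrite (nth_map [::]) ?size_b. Qed.

Let size_rows_pow : size (rows (skew_pow S b)) = b.
Proof. by rewrite /= size_map. Qed.

Let offs_size_pow : size (offs (skew_pow S b)) = size (rows (skew_pow S b)).
Proof. by rewrite size_rows_pow /= offs_size. Qed.

Lemma size_grid_pow : size G = b.
Proof. by rewrite /to_grid size_map size_zip offs_size_pow minnn size_rows_pow. Qed.

Lemma len_grid_pow a : len G a = if a < b then o a + b * r else 0.
Proof.
rewrite /len; case: ltnP => ab; last by rewrite nth_default // size_grid_pow.
rewrite (nth_to_grid offs_size_pow) ?size_rows_pow // size_cat size_nseq size_map nth_rows_pow //.
by rewrite size_row_power size_w.
Qed.

Lemma cell_grid_pow a c : cell G a c =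
  if (a < b) && (o a <= c < o a + b * r) then Some (power_entry a (c - o a)) else None.
Proof.
case: (ltnP a b) => ab /=; last by rewrite /cell (nth_default [::]) ?nth_nil // size_grid_pow.
rewrite (cell_to_grid _ offs_size_pow) ?size_rows_pow // nth_rows_pow //.
change (nth 0 (offs (skew_pow S b)) a) with (o a).
case: (ltnP c (o a)) => oc //; case: (ltnP c (o a + b * r)) => ck /=.
  have lt : c - o a < b * size (w a) by rewrite size_w //; lia.
  by rewrite (nth_map 0) ?size_row_power // nth_row_power // /power_entry size_w.
by rewrite nth_default // size_map size_row_power size_w //; lia.
Qed.

Lemma power_entry_bounds a p : a < b ->
  p %/ r * m < power_entry a p <= (p %/ r).+1 * m.
Proof.
move=> ab; have := w_nth_bounds ab (ltn_pmod p r0); rewrite /power_entry mulSn; lia.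
Qed.

Lemma power_entry_ltn a a' p p' : a < b -> a' < b -> p %/ r < p' %/ r ->
  power_entry a p < power_entry a' p'.
Proof.
move=> ab ab' lt; have := power_entry_bounds p ab; have := power_entry_bounds p' ab'.
have : (p %/ r).+1 * m <= p' %/ r * m by rewrite leq_mul2r lt orbT.
lia.
Qed.

Lemma power_entry_row a p p' : a < b -> p < p' -> power_entry a p < power_entry a p'.
Proof.
move=> ab pp; have := leq_div2r r (ltnW pp); rewrite leq_eqVlt => /orP[/eqP E|].
  rewrite /power_entry E ltn_add2r w_ltn ?ltn_pmod //.
  by have := divn_eq p r; have := divn_eq p' r; rewrite E; lia.
exact: power_entry_ltn.
Qed.

(** All rows have length [r], so the copies in adjacent rows keep the same relative shift [d].
    Moving [d] places either enters a later block, with larger entries, or stays in the block, where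
    the column condition of [S] applies. *)
Lemma power_entry_col a p : a.+1 < b ->
  power_entry a p < power_entry a.+1 (p + (o a - o a.+1)).
Proof.
move=> ab; set d := _ - _.
have := leq_div2r r (leq_addr d p); rewrite leq_eqVlt => /orP[/eqP E|]; last first.
  by apply: power_entry_ltn; rewrite // ltnW.
have E2 : (p + d) %% r = p %% r + d.
  by have := divn_eq p r; have := divn_eq (p + d) r; rewrite E; lia.
rewrite /power_entry -E E2 ltn_add2r; apply: w_col => //.
by rewrite -/d -E2 ltn_pmod.
Qed.

Lemma power_entry_inj a a' p p' : a < b -> a' < b ->
  power_entry a p = power_entry a' p' -> a = a' /\ p = p'.
Proof.
move=> ab ab' E.
have Ed : p %/ r = p' %/ r.
  case: (ltngtP (p %/ r) (p' %/ r)) => // lt.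
    by have := power_entry_ltn ab ab' lt; rewrite E ltnn.
  by have := power_entry_ltn ab' ab lt; rewrite E ltnn.
have Ea : a = a'.
  move: E; rewrite /power_entry Ed => /addIn E.
  have [_ _ _ _ pe] := std.
  have u : uniq (flatten (rows S)) by rewrite (perm_uniq pe) iota_uniq.
  apply: (uniq_flatten_nth (x := nth 0 (w a) (p %% r)) u).
    by rewrite mem_nth // size_w // ltn_pmod.
  by rewrite E mem_nth // size_w // ltn_pmod.
split=> //; rewrite -Ea in E.
case: (ltngtP p p') => // lt; by have := power_entry_row ab lt; rewrite E ltnn.
Qed.

Lemma skew_grid_pow : skew_grid G (fun a => o a) None.
Proof.
have [[_ so] _ _ _ _] := std.
have le a a' := @sorted_geq_nth (offs S) a a' so.
have col a c x y : cell G a c = Some x -> cell G a.+1 c = Some y -> x < y.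
  rewrite !cell_grid_pow; case: ifP => // /and3P[ab oc ck] [<-].
  case: ifP => // /and3P[ab' oc' ck'] [<-].
  have -> : c - o a.+1 = c - o a + (o a - o a.+1) by have := le a a.+1 (leqnSn a); lia.
  exact: power_entry_col.
have row a c c' x y : c <= c' -> cell G a c = Some x -> cell G a c' = Some y -> x <= y.
  rewrite leq_eqVlt => /orP[/eqP <- -> [<-] //|cc].
  rewrite !cell_grid_pow; case: ifP => // /and3P[ab oc ck] [<-].
  case: ifP => // /and3P[_ oc' ck'] [<-]; apply/ltnW/power_entry_row => //; lia.
split.
- by move=> a a' /le.
- move=> a a' aa; rewrite !len_grid_pow; case: (ltnP a' b) => // ab'.
  by rewrite (leq_ltn_trans aa ab') leq_add2r le.
- move=> a; rewrite len_grid_pow; case: ifP => [_|/negbT]; first exact: leq_addr.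
  by rewrite -leqNgt => ba; rewrite nth_default // offs_size size_b.
- by [].
- move=> a c; rewrite cell_grid_pow len_grid_pow andbT; case: (a < b) => /=; first by case: ifP.
  by rewrite ltn0 andbF.
- move=> a a' c c' x y aa cc X.
  elim: a' y aa => [|a' IH] y.
    by rewrite leqn0 => /eqP E; rewrite E in X; exact: row cc X.
  rewrite leq_eqVlt => /orP[/eqP E|aa]; first by rewrite -E; exact: row cc X.
  (* The intermediate cell exists because row [a'] starts no later than row [a] and ends no earlier
     than row [a'.+1]. *)
  move=> Y; have [z Z] : exists z, cell G a' c' = Some z.
    move: X Y; rewrite !cell_grid_pow.
    case: ifP => // /and3P[ab oc ck] _; case: ifP => // /and3P[ab' oc' ck'] _.
    have -> : (a' < b) && (o a' <= c' < o a' + b * r); last by eexists.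
    have := le a a' aa; have := le a' a'.+1 (leqnSn a'); lia.
  by apply/ltnW; apply: leq_ltn_trans (IH z aa Z) (col _ _ _ _ Z Y).
- move=> a a' c c' x; rewrite !cell_grid_pow.
  case: ifP => // /and3P[ab oc ck] [<-]; case: ifP => // /and3P[ab' oc' ck'] [E].
  have [Ea Ep] := power_entry_inj ab' ab E; split=> //.
  by rewrite Ea in Ep oc'; lia.
Qed.

Lemma cell_grid_pow_le a c e : cell G a c = Some e -> e <= b * m.
Proof.
rewrite cell_grid_pow; case: ifP => // /and3P[ab oc ck] [<-].
have /andP[_ h] := power_entry_bounds (c - o a) ab; apply: leq_trans h _.
rewrite leq_mul2r; apply/orP; right; rewrite ltn_divLR //; lia.
Qed.

(** * Optimal moments for climbing *)

Definition block_count a l := \sum_(x <- w a) (x <= l).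

Lemma row_count_pow B a q l : len G 0 <= B -> a < b -> l < m ->
  row_count B (cell G) a (q * m + l) = minn q b * r + (q < b) * block_count a l.
Proof.
move=> lB ab lm.
have sB : size (nth [::] G a) <= B.
  by apply: leq_trans lB; exact: (len_le skew_grid_pow (leq0n a)).
rewrite row_countE (sum_nth_None (F := fun o => wt (fun e _ => e <= q * m + l) o a)) //.
rewrite (nth_to_grid offs_size_pow) ?size_rows_pow // big_cat /= big_nseq big_map nth_rows_pow //.
rewrite row_count_power_seq ?size_w //; last by move=> x; exact: w_bounds.
by rewrite iter_fix.
Qed.

Lemma row_count_pow_mul B a q : len G 0 <= B -> a < b -> q <= b ->
  row_count B (cell G) a (q * m) = q * r.
Proof.
move=> lB ab qk; rewrite -[q * m]addn0 row_count_pow ?ncells_gt0 //.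
have -> : minn q b = q by lia.
rewrite /block_count big_seq big1 ?muln0 ?addn0 // => x /w_bounds; lia.
Qed.

Lemma row_count_pow_out B a n : b <= a -> row_count B (cell G) a n = 0.
Proof.
by move=> ba; rewrite row_countE big1 // => c _; rewrite cell_grid_pow ltnNge ba.
Qed.

Lemma block_count0 a : block_count a 0 = 0.
Proof. by rewrite /block_count big_seq big1 // => x /w_bounds; lia. Qed.

(** A moment within a block at which row [a.+1] leads row [a] by the most; [switch_gain a] is that
    lead, the number [M_a] of the overview. *)
Definition switch_time a : nat :=
  sval (argmax_diff (m := m) ncells_gt0 (etrans (block_count0 a) (esym (block_count0 a.+1)))).

Definition switch_gain a :=
  block_count a.+1 (switch_time a) - block_count a (switch_time a).

Lemma switch_timeP a :
  [/\ switch_time a < m, block_count a (switch_time a) <= block_count a.+1 (switch_time a)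
    & forall l, l < m -> block_count a.+1 l + block_count a (switch_time a)
                         <= block_count a l + block_count a.+1 (switch_time a)].
Proof. by rewrite /switch_time; case: argmax_diff. Qed.

(** Complete blocks contribute [r] entries to either row, so the lead of row [a.+1] depends only on
    the time within the current block. *)
Lemma row_count_gain B a n : len G 0 <= B ->
  row_count B (cell G) a.+1 n <= row_count B (cell G) a n + switch_gain a.
Proof.
move=> lB; have [ab|ba] := ltnP a.+1 b; last by rewrite row_count_pow_out.
have [_ le max] := switch_timeP a.
rewrite (divn_eq n m) !row_count_pow ?(ltnW ab) ?ltn_pmod ?ncells_gt0 //.
have := max _ (ltn_pmod n ncells_gt0); rewrite /switch_gain.
by case: (_ < b); rewrite ?mul1n ?mul0n; lia.
Qed.

Lemma row_count_switch B a q : len G 0 <= B -> a.+1 < b -> q < b ->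
  row_count B (cell G) a.+1 (q * m + switch_time a) =
  row_count B (cell G) a (q * m + switch_time a) + switch_gain a.
Proof.
move=> lB ab qk; have [lt le max] := switch_timeP a.
rewrite !row_count_pow ?(ltnW ab) // qk !mul1n /switch_gain; lia.
Qed.

(* Particle [c] makes its [s]-th upward step, from row [b - j + c - s], during
   block [c + s]; the delay by [c] keeps it behind particle [c - 1]. *)
Definition switch_schedule j c s :=
  (c + s) * m + switch_time ((b - j + c) - s.+1).

Definition best_particles j c e :=
  (b - j + c) - \sum_(s < b - j) (switch_schedule j c s < e).

Lemma switch_schedule_ltn j c s s' : s < s' ->
  switch_schedule j c s < switch_schedule j c s'.
Proof.
move=> ss; have [lt _ _] := switch_timeP (b - j + c - s.+1).
have : (c + s).+1 * m <= (c + s') * m by rewrite leq_mul2r -addnS leq_add2l ss orbT.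
rewrite /switch_schedule mulSn; lia.
Qed.

Let sum_le j c e : \sum_(s < b - j) (switch_schedule j c s < e) <= b - j.
Proof.
rewrite -[leqRHS]card_ord -sum1_card; apply: leq_sum => s _; exact: leq_b1.
Qed.

(** For [c < c'], the step number [s] of [c'] falls in a later block than that of [c]. So [c'] has
    never made more steps than [c], and their initial distance [c' - c] never shrinks. *)
Lemma best_particlesP j : j <= b -> particles b j (best_particles j).
Proof.
move=> jb; split=> [c c' e cc cj|c e cj|c e cj]; last first.
- by rewrite /best_particles; lia.
- rewrite /best_particles leq_sub2l //; apply: leq_sum => s _.
  by case: (ltnP _ e) => // /leqW ->.
have h : \sum_(s < b - j) (switch_schedule j c' s < e)
      <= \sum_(s < b - j) (switch_schedule j c s < e).
  apply: leq_sum => s _; case: (ltnP _ e) => // lt.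
  have [t1 _ _] := switch_timeP (b - j + c - s.+1).
  have : (c + s).+1 * m <= (c' + s) * m by rewrite leq_mul2r -addSn leq_add2r cc orbT.
  move=> le; suff -> : switch_schedule j c s < e by [].
  by apply: leq_ltn_trans lt; rewrite /switch_schedule; rewrite mulSn in le; lia.
by have := sum_le j c e; have := sum_le j c' e; rewrite /best_particles; lia.
Qed.

Lemma best_particles_step B j c e : len G 0 <= B -> j <= b -> c < j ->
  let p := best_particles j c in
  p e.+1 = p e \/ p e = (p e.+1).+1 /\
    row_count B (cell G) (p e) e = row_count B (cell G) (p e.+1) e + switch_gain (p e.+1).
Proof.
move=> lB jb cj p.
case: (@count_below_step (b - j) (switch_schedule j c) e).
- by move=> s s' ss _; exact: switch_schedule_ltn.
- by move=> E; left; rewrite /p /best_particles E.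
case=> s [sh E E1 E2]; right.
have P1 : p e = b - j + c - s by rewrite /p /best_particles E1.
have P2 : p e.+1 = b - j + c - s.+1 by rewrite /p /best_particles E2.
have P3 : p e = (p e.+1).+1 by lia.
have Ee : e = (c + s) * m + switch_time (p e.+1) by rewrite P2 -E.
have := @row_count_switch B (p e.+1) (c + s) lB ltac:(lia) ltac:(lia).
by rewrite -Ee -P3.
Qed.

Lemma best_particles_start j c : best_particles j c 0 = b - j + c.
Proof. by rewrite /best_particles big1 ?subn0. Qed.

(** Since [c < j] and [s < b - j], the block index [c + s] is at most [b - 2]. Blocks being numbered
    from 0, every step is made before the last block begins; this is where the bound [b] comes
    from. *)
Lemma best_particles_end j c : j <= b -> c < j -> best_particles j c (b.-1 * m) = c.
Proof.
move=> jb cj; rewrite /best_particles (eq_bigr (fun=> 1)).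
  by rewrite sum1_card card_ord; lia.
move=> s _; have [lt _ _] := switch_timeP (b - j + c - s.+1).
have : (c + s).+1 * m <= b.-1 * m by rewrite leq_mul2r; have := ltn_ord s; lia.
rewrite /switch_schedule mulSn => h.
by have -> : (c + s) * m + switch_time (b - j + c - s.+1) < b.-1 * m by lia.
Qed.

(** * The last block in the rectification *)

Local Notation F := (Rect (skew_pow S b)).
Local Notation B := (len G 0).

Let SG : skew_grid G (fun a => nth 0 (offs S) a) None.
Proof. exact: skew_grid_pow. Qed.

Let rectP : [/\ skew_grid F (fun=> 0) None, size F = b, len F 0 <= B & dominates b B (cell G) (cell F)].
Proof.
have sG : size G = b by exact: size_grid_pow.
apply: (rect_fuelP SG sG (leqnn _)).
rewrite ltnS gsizeE sG; apply: leq_sum => a _; exact: mu_len SG a.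
Qed.

Definition last_block (e : nat) := b.-1 * m < e <= b * m.

Lemma weight_last_block_init j : j <= b ->
  weight b B (cell G) (fun e a => last_block e && (a < j)) = j * r.
Proof.
move=> jb; have P := particles_const jb.
have W n : weight b B (cell G) (fun e a => (e <= n) && (a < j)) =
    \sum_(c < j) row_count B (cell G) c n.
  rewrite -(weight_occ B (cell G) n P); apply: eq_bigr => a _; apply: eq_bigr => c _.
  by case: (cell G a c) => //= e; rewrite occ_const.
have le : b.-1 * m <= b * m by rewrite leq_mul2r leq_pred orbT.
have add : weight b B (cell G) (fun e a => (e <= b * m) && (a < j)) =
    weight b B (cell G) (fun e a => (e <= b.-1 * m) && (a < j)) +
    weight b B (cell G) (fun e a => last_block e && (a < j)).
  apply: weight_add => e a; rewrite /last_block.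
  case: (a < j); rewrite ?andbF // !andbT.
  by case: (leqP e (b.-1 * m)) => h; case: (leqP e (b * m)) => //=; lia.
have R q c : c < j -> q <= b -> row_count B (cell G) c (q * m) = q * r.
  by move=> cj qb; apply: row_count_pow_mul => //; apply: leq_trans jb.
move: add; rewrite !W (eq_bigr (fun=> b * r)); last by move=> c _; exact: R.
rewrite [X in _ = X + _](eq_bigr (fun=> b.-1 * r)); last by move=> c _; apply: R => //; exact: leq_pred.
rewrite !sum_nat_const card_ord -{1}(prednK b0) mulSn mulnDr addnC.
by move=> /addnI.
Qed.

(** In the first [j] rows of [F], [upper] bounds all entries from above and [lower] bounds those
    preceding the last block from below. Both contain the same [gains], which cancel. *)
Lemma weight_last_block_rect j : j <= b ->
  weight b B (cell F) (fun e a => last_block e && (a < j)) <= j * r.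
Proof.
move=> jb; have P := particles_const jb; have [SF _ _ [D1 D2 _]] := rectP.
pose gains := \sum_(c < j) \sum_(c <= i < b - j + c) switch_gain i.
have upper : weight b B (cell F) (fun _ a => a < j) <= j * (b * r) + gains.
  (* The first [j] rows of [F] are the score of motionless particles, which is carried back to
     [G]. *)
  have [pos Q le] := D2 j _ P.
  apply: (@leq_trans (weight b B (cell F) (occ j (fun c _ => c)))).
    by apply: weight_mono => a c e _ _; rewrite occ_const.
  apply: leq_trans le _.
  apply: (@leq_trans (weight b B (cell G) (fun e a => (e <= b * m) && occ j pos e a))).
    apply: weight_mono => a c e _ E ->; rewrite andbT.
    exact: cell_grid_pow_le E.
  rewrite (weight_occ _ _ _ Q) /gains.
  have -> : j * (b * r) = \sum_(c < j) b * r by rewrite sum_nat_const card_ord.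
  rewrite -big_split; apply: leq_sum => c _ /=; have [_ dec _] := Q.
  rewrite -(@row_count_pow_mul B c b) //; last exact: leq_trans jb.
  apply: particle_upper => [e|a n||].
  - exact: dec.
  - exact: row_count_gain.
  - by have [] := particles_bounds (b * m) Q (ltn_ord c).
  - by have := particles_bounds 0 Q (ltn_ord c); have := ltn_ord c; lia.
have lower : j * (b.-1 * r) + gains <=
    weight b B (cell F) (fun e a => (e <= b.-1 * m) && (a < j)).
  have Pb := best_particlesP jb.
  (* The scheduled family realises all gains in [G] by time [b.-1 * m], and its score is carried
     forward to [F]. *)
  have [pos Q le] := D1 (b.-1 * m) j _ Pb.
  apply: (@leq_trans (\sum_(c < j) row_count B (cell F) c (b.-1 * m))); last first.
    rewrite -(weight_occ B (cell F) _ P); apply: weight_mono => a c e _ _.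
    by rewrite occ_const.
  apply: leq_trans (leq_trans le _).
    rewrite (weight_occ _ _ _ Pb) /gains.
    have -> : j * (b.-1 * r) = \sum_(c < j) b.-1 * r by rewrite sum_nat_const card_ord.
    rewrite -big_split; apply: leq_sum => c _ /=.
    rewrite (particle_eq (M := switch_gain)).
      rewrite best_particles_end // best_particles_start.
      rewrite -/(row_count _ _ _ _) row_count_pow_mul ?leq_pred //; exact: leq_trans jb.
    by move=> e; exact: best_particles_step.
  (* In the straight shape [F], particle [c] never gets above row [c], so it scores at most the
     count of row [c]. *)
  rewrite (weight_occ _ _ _ Q); apply: leq_sum => c _; have [_ dec _] := Q.
  apply: leq_trans (particle_upper (d := mult B (cell F)) (M := fun=> 0) (c := c) _ _ _ (leqnn _)) _.
  - by move=> e; exact: dec.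
  - by move=> a n; rewrite addn0; exact: straight_row_count.
  - by have [] := particles_bounds (b.-1 * m) Q (ltn_ord c).
  - by rewrite big1 // addn0.
have add : weight b B (cell F) (fun _ a => a < j) =
    weight b B (cell F) (fun e a => (e <= b.-1 * m) && (a < j)) +
    weight b B (cell F) (fun e a => (b.-1 * m < e) && (a < j)).
  by apply: weight_add => e a; rewrite (ltnNge _ e); case: (e <= _); case: (a < j).
have mono : weight b B (cell F) (fun e a => last_block e && (a < j)) <=
    weight b B (cell F) (fun e a => (b.-1 * m < e) && (a < j)).
  by apply: weight_mono => a c e _ _ /andP[/andP[-> _] ->].
have eq : j * (b * r) = j * (b.-1 * r) + j * r by rewrite -{1}(prednK b0) mulSn mulnDr addnC.
lia.
Qed.

Lemma weight_rect_mono (Q : nat -> nat -> bool) : (forall e a, Q e a.+1 -> Q e a) ->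
  weight b B (cell G) Q <= weight b B (cell F) Q.
Proof. by have [_ _ _ [_ _ D3]] := rectP; exact: D3. Qed.

(** If [e] lay outside the first [j] rows of [G], the [j * r] entries of the last block in those
    rows would all differ from [e]. They stay in these rows of [F], so [e] would be one entry too
    many there. *)
Lemma last_block_above e j : j <= b -> last_block e ->
  0 < weight b B (cell F) (fun x a => (x == e) && (a < j)) ->
  0 < weight b B (cell G) (fun x a => (x == e) && (a < j)).
Proof.
move=> jb le; rewrite !lt0n; apply: contra_neq => G0.
have split f : weight b B f (fun x a => last_block x && (a < j)) =
   weight b B f (fun x a => (x == e) && (a < j)) +
   weight b B f (fun x a => [&& last_block x, x != e & a < j]).
  apply: weight_add => x a; have [->|ne] := eqVneq x e; first by rewrite le andbF addn0.
  by rewrite add0n.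
have up := weight_rect_mono (Q := fun x a => [&& last_block x, x != e & a < j]).
have {}up := up (fun x a => ltac:(by case/and3P => -> -> /ltnW)).
have := weight_last_block_rect jb; rewrite -(weight_last_block_init jb) !split G0; lia.
Qed.

Lemma row_of_ltn T e j : size T = b -> len T 0 <= B -> (forall a, len T a <= len T 0) ->
  j <= b -> (row_of T e < j) = (0 < weight b B (cell T) (fun x a => (x == e) && (a < j))).
Proof.
move=> sT lB l0 jb; rewrite /row_of; apply/idP/weight_gt0.
  set f := find _ _ => fj; have fb := leq_trans fj jb.
  have : has (fun row : seq (option nat) => Some e \in row) T by rewrite has_find sT.
  move=> /(nth_find [::]) /(nthP None)[c lc E].
  exists f, c, e; split=> //; last by rewrite eqxx.
  by apply: leq_trans lc (leq_trans (l0 f) lB).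
case=> a [c [x [ab _ E /andP[/eqP xe aj]]]].
apply: leq_trans aj; rewrite ltnS leqNgt; apply/negP => /(before_find [::]) /negP; apply.
rewrite -xe -E mem_nth // ltnNge; apply/negP => lc.
by rewrite /cell nth_default in E.
Qed.

Lemma row_of_rect e : last_block e -> row_of F e = row_of G e.
Proof.
move=> le; have [SF sF lF _] := rectP; have sG : size G = b by exact: size_grid_pow.
have rF j : j <= b -> _ := row_of_ltn e sF lF (fun a => len_le SF (leq0n a)).
have rG j : j <= b -> _ := row_of_ltn e sG (leqnn _) (fun a => len_le SG (leq0n a)).
have same j : j <= b -> (row_of F e < j) = (row_of G e < j).
  move=> jb; rewrite rF // rG //; apply/idP/idP; first exact: last_block_above.
  move=> h; apply: leq_trans h _; apply: weight_rect_mono => x a /andP[-> /ltnW].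
  by move=> ->.
(* A miss of [find] returns the number of rows, so both values are at most [b], and comparing them
   with all [j <= b] determines them. *)
have Fb : row_of F e <= b by rewrite -[leqRHS]sF /row_of find_size.
have Gb : row_of G e <= b by rewrite -[leqRHS]sG /row_of find_size.
case: (ltngtP (row_of F e) (row_of G e)) => // lt.
  by have := same _ Gb; rewrite lt ltnn.
by have := same _ Fb; rewrite lt ltnn.
Qed.

End Power.

Theorem theorem1p4 (b r : nat) (S : skew) :
  1 <= b -> 1 <= r ->
  is_standard_skew S ->
  size (rows S) = b ->
  all (fun w => size w == r) (rows S) ->
  stabilizes_at S b /\ stab_le S b.
Proof.
move=> b0 r0 std size_b all_r.
have st : stabilizes_at S b by move=> e; exact: row_of_rect b0 r0 std size_b all_r e.
by split=> //; exists b.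
Qed.
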